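(* For any diagram $D\subseteq[n]\times[n]$, the number $\theta_D$ of supports of the dual character $\chi_D(x)$ satisfies $$\theta_D\ \ge\ 1+r_1(D)+r_2(D)+r_3(D).$$
   Context: A diagram is a subset $D$ of boxes of $[n]\times[n]$; box $(i,j)$ is in row $i$ (rows numbered from top to bottom) and column $j$. Write $D=(D_1,\ldots,D_n)$ with $D_j=\{i:(i,j)\in D\}$. For $k$-subsets $R=\{r_1<\cdots<r_k\}$, $S=\{s_1<\cdots<s_k\}$ of $[n]$, $R\le S$ means $r_t\le s_t$ for all $t$; for diagrams, $C\le D$ means $C_j\le D_j$ for all $j$. Let $Y$ be the upper-triangular $n\times n$ matrix of indeterminates $y_{ij}$ ($i\le j$), $B$ the group of invertible upper-triangular complex matrices acting on $\mathbb{C}[Y]$ by $f(Y)\cdot b=f(b^{-1}Y)$, $Y^R_S$ the submatrix with rows $R$ and columns $S$, and $\det(Y^C_D)=\prod_j\det(Y^{C_j}_{D_j})$. The flagged Weyl module is $\mathcal{M}_D=\mathrm{Span}_{\mathbb{C}}\{\det(Y^C_D):C\le D\}$, and its dual character is $\chi_D(x_1,\ldots,x_n)=\mathrm{tr}(X:\mathcal{M}_D\to\mathcal{M}_D)$ evaluated at $X=\mathrm{diag}(x_1^{-1},\ldots,x_n^{-1})$. $\theta_D$ is the number of exponent vectors $\alpha$ with $x^\alpha$ having nonzero coefficient in $\chi_D(x)$. $r_1(D)$ is the number of pairs of boxes $\{(i_1,j),(i_2,j)\}$ with $i_1<i_2$ such that $(i_1,j)\notin D$ and $(i_2,j)\in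 D$. $r_2(D)$ is the number of 6-box sets $\{i_1,i_2,i_3\}\times\{j_1,j_2\}$ with $i_1<i_2<i_3$, $j_1<j_2$ such that either (B) exactly $(i_2,j_1),(i_2,j_2),(i_3,j_1)$ among them lie in $D$, or (B') exactly $(i_2,j_1),(i_2,j_2),(i_3,j_2)$ among them lie in $D$. $r_3(D)$ is the number of 4-box sets $\{(i_1,a),(i_2,a),(i_3,b),(i_4,b)\}$ with $i_1<i_2<i_3<i_4$ such that $(i_1,a),(i_3,b)\notin D$ and $(i_2,a),(i_4,b)\in D$, where either (C) $a<b$, or (C') $a>b$, or (C'') $a=b$. *)

(* Defs.v *)
From HB Require Import structures.
From Stdlib Require Import ClassicalEpsilon.
From mathcomp Require Import all_boot all_order all_algebra.
From mathcomp Require Import reals complex mpoly.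

Set Implicit Arguments.
Unset Strict Implicit.
Unset Printing Implicit Defensive.

Import GRing.Theory.
Local Open Scope ring_scope.

(* Rows and columns are indexed from 0, by 'I_n; row 0 is the top row. *)

Section Diagrams.
Variable n : nat.

Definition box : finType := ('I_n * 'I_n)%type.
Definition diagram := {set box}.

Definition dcol (D : diagram) (j : 'I_n) : {set 'I_n} :=
  [set i | (i, j) \in D].

(* [enum S] lists S increasingly, and [all2] requires equal lengths, so
   [set_le R S] includes #|R| = #|S|. *)
Definition set_le (R S : {set 'I_n}) : bool :=
  all2 (fun r s : 'I_n => r <= s)%N (enum R) (enum S).

Definition diagram_le (C D : diagram) : bool :=
  [forall j, set_le (dcol C j) (dcol D j)].

Definition r1 (D : diagram) : nat :=
  #|[set E : {set box} | [exists i1 : 'I_n, exists i2 : 'I_n, exists j : 'I_n,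
      [&& (i1 < i2)%N, (i1, j) \notin D, (i2, j) \in D
        & E == [set (i1, j); (i2, j)]]]]|.

Definition r2 (D : diagram) : nat :=
  #|[set E : {set box} |
      [exists i1 : 'I_n, exists i2 : 'I_n, exists i3 : 'I_n,
       exists j1 : 'I_n, exists j2 : 'I_n,
      [&& (i1 < i2)%N, (i2 < i3)%N, (j1 < j2)%N,
          E == setX [set i1; i2; i3] [set j1; j2]
        & (E :&: D == [set (i2, j1); (i2, j2); (i3, j1)])
          || (E :&: D == [set (i2, j1); (i2, j2); (i3, j2)])]]]|.

(* Configurations (C), (C'), (C'') are the cases a < b, a > b, a = b;
   together they put no condition on a and b. *)
Definition r3 (D : diagram) : nat :=
  #|[set E : {set box} |
      [exists i1 : 'I_n, exists i2 : 'I_n, exists i3 : 'I_n, exists i4 : 'I_n,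
       exists a : 'I_n, exists b : 'I_n,
      [&& (i1 < i2)%N, (i2 < i3)%N, (i3 < i4)%N,
          [&& (i1, a) \notin D, (i3, b) \notin D, (i2, a) \in D
            & (i4, b) \in D]
        & E == [set (i1, a); (i2, a); (i3, b); (i4, b)]]]]|.

End Diagrams.

Section Trace.
Variables (K : fieldType) (V : lmodType K).

Definition lin_span (S : V -> Prop) (v : V) : Prop :=
  exists m (s : 'I_m -> V) (c : 'I_m -> K),
    (forall i, S (s i)) /\ v = \sum_i c i *: s i.

Definition is_basis (W : V -> Prop) m (e : 'I_m -> V) : Prop :=
  (forall i, W (e i)) /\
  (forall v, W v -> exists! c : 'rV[K]_m, v = \sum_i c 0 i *: e i).

(* t is the trace of the endomorphism of W induced by f: in particular W is
   finite-dimensional and stable under f.  The polynomial ring C[Y] is not a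
   vectType, so the trace is read off a basis of W. *)
Definition is_trace (W : V -> Prop) (f : V -> V) (t : K) : Prop :=
  exists m (e : 'I_m -> V) (A : 'M[K]_m),
    [/\ is_basis W e, forall i, f (e i) = \sum_j A i j *: e j & t = \tr A].

End Trace.

Section FlaggedWeyl.
Variables (K : fieldType) (n : nat).

Definition utri : finType := {p : 'I_n * 'I_n | (p.1 <= p.2)%N}.

Definition polyY := {mpoly K[#|utri|]}.

Definition matY : 'M[polyY]_n :=
  \matrix_(i, j) if insub (i, j) is Some u then 'X_(enum_rank (u : utri))
                 else 0.

(* f(Y) . b = f(b^-1 Y), for b invertible and upper triangular: the
   indeterminate y_ij is replaced by the (i, j) entry of b^-1 Y. *)
Definition act (f : polyY) (b : 'M[K]_n) : polyY :=
  f \mPo [tuple (map_mx (@mpolyC #|utri| K) (invmx b) *m matY)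
                  (val (enum_val k)).1 (val (enum_val k)).2 | k < #|utri|].

Definition submatY (R S : {set 'I_n}) : 'M[polyY]_(#|R|, #|S|) :=
  mxsub (@enum_val _ (mem R)) (@enum_val _ (mem S)) matY.

(* [conform_mx] only casts [submatY R S] to a square matrix; the minor is
   meaningful, and used, when #|R| = #|S|. *)
Definition minorY (R S : {set 'I_n}) : polyY :=
  \det (conform_mx (0 : 'M_#|S|) (submatY R S)).

Definition detY (C D : diagram n) : polyY :=
  \prod_(j < n) minorY (dcol C j) (dcol D j).

Definition weyl_module (D : diagram n) : polyY -> Prop :=
  lin_span (fun p => exists2 C : diagram n, diagram_le C D & p = detY C D).

Definition is_dual_character (D : diagram n) (chi : {mpoly K[n]}) : Prop :=
  forall x : 'I_n -> K, (forall i, x i != 0) ->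
    is_trace (weyl_module D)
      (fun f => act f (diag_mx (\row_i (x i)^-1))) chi.@[x].

(* Over an infinite field at most one polynomial takes the prescribed values
   on the torus; if there were none, [dual_character] would be an unspecified
   polynomial, about which no bound could be derived. *)
Definition dual_character (D : diagram n) : {mpoly K[n]} :=
  epsilon (inhabits 0) (is_dual_character D).

Definition theta (D : diagram n) : nat := size (msupp (dual_character D)).

End FlaggedWeyl.

(* Main.v *)
(** The torus scales det(Y^C_D) by x^wt(C), where wt(C)_i counts the boxes of C
    in row i, and det(Y^C_D) is nonzero when C <= D.  Hence, in characteristic 0,
    the support of the dual character is exactly the set of weights wt(C), C <= D.

    Call a column (a,b)-movable, a < b, if its box in row a is empty and its box
    in row b is full; moving b up to a in k such columns changes the weight by
    k(e_a - e_b).  Picking a pair counted by r_1 amounts to picking rows a < b and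
    k at most the number of movable columns, and yields wt(D) + k(e_a - e_b).
    Pairs of moves account for r_2, with wt(D) + k(e_1 - e_3) + l(e_1 - e_2), and
    for r_3, with wt(D) + k(e_1 - e_2) + l(e_3 - e_4), the e's being indexed by
    the rows of the configuration.  These weights differ from wt(D) in exactly
    2, 3 and 4 rows respectively, and each determines its configuration. *)
Require Import Defs.
From HB Require Import structures.
From Stdlib Require Import Classical ClassicalEpsilon.
From mathcomp Require Import all_boot all_order all_algebra.
From mathcomp Require Import reals complex mpoly.
From mathcomp Require Import perm zify.

Set Implicit Arguments.
Unset Strict Implicit.
Unset Printing Implicit Defensive.

Import Order.TTheory GRing.Theory Num.Theory.
Local Open Scope ring_scope.

(** * Polynomials vanishing on the torus *)

(** Uniqueness of base-[N] digits: the lowest is read off modulo [N], the others by induction. *)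
Lemma digits_inj (N n : nat) (f g : 'I_n -> nat) :
  (forall i, f i < N)%N -> (forall i, g i < N)%N ->
  (\sum_(i < n) f i * N ^ i = \sum_(i < n) g i * N ^ i)%N -> f =1 g.
Proof.
elim: n f g => [|n IHn] f g ltf ltg; first by move=> _ [].
have N_gt0 : (0 < N)%N by apply: leq_ltn_trans (ltf ord0).
have shift h : (\sum_(i < n.+1) h i * N ^ i =
    (\sum_(i < n) h (lift ord0 i) * N ^ i) * N + h ord0)%N.
  rewrite big_ord_recl /= expn0 muln1 addnC; congr (_ + _)%N.
  rewrite big_distrl /=; apply: eq_bigr => i _.
  by rewrite /bump /= add1n expnSr mulnA.
rewrite !shift => eqfg.
have eq0 : f ord0 = g ord0.
  have := congr1 (modn^~ N) eqfg.
  by rewrite !modnMDl !modn_small.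
move: eqfg; rewrite eq0 => /addIn/eqP; rewrite eqn_pmul2r // => /eqP eqS.
move=> i; case: (unliftP ord0 i) => [j ->|-> //].
by apply: (IHn (fun j => f (lift ord0 j)) (fun j => g (lift ord0 j))).
Qed.

(** All exponents of [p] are below [N], so the substitution sends distinct monomials to distinct
    powers of [t]; the coefficients of [p] survive in a univariate [q]. *)
Lemma mpoly_eq0_torus (K : numFieldType) n (p : {mpoly K[n]}) :
  (forall x : 'I_n -> K, (forall i, x i != 0) -> p.@[x] = 0) -> p = 0.
Proof.
move=> p_eq0; pose N := msize p.
(* Kronecker substitution [x_i := t ^ (N ^ i)]. *)
pose phi (m : 'X_{1..n}) := (\sum_(i < n) m i * N ^ i)%N.
have ltN m i : m \in msupp p -> (m i < N)%N.
  move=> /msize_mdeg_lt; apply: leq_ltn_trans.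
  by rewrite mdegE (bigD1 i) //= leq_addr.
have phi_inj : {in msupp p &, injective phi}.
  move=> m1 m2 m1p m2p eq_phi; apply/mnmP.
  by apply: digits_inj eq_phi => i; apply: ltN.
pose q : {poly K} := \sum_(m <- msupp p) p@_m *: 'X^(phi m).
have horner_q t : q.[t] = p.@[fun i => t ^+ (N ^ i)].
  rewrite mevalE /q horner_sum; apply: eq_bigr => m _.
  rewrite hornerZ hornerXn; congr (_ * _); rewrite /phi.
  rewrite (big_morph (fun k => t ^+ k) (exprD t) (expr0 t)).
  by apply: eq_bigr => i _; rewrite mulnC exprM.
have q0 : q = 0.
  apply/eqP; apply: contraT => qn0.
  (* The integers [1, ..., size q] are nonzero and distinct in characteristic 0: one root too many
     for a nonzero [q]. *)
  pose rs : seq K := [seq k.+1%:R | k <- iota 0 (size q)].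
  have rs_root : all (root q) rs.
    apply/allP => _ /mapP[k _ ->]; apply/rootP; rewrite horner_q p_eq0 // => i.
    by rewrite expf_neq0 // pnatr_eq0.
  have rs_uniq : uniq rs.
    rewrite map_inj_uniq ?iota_uniq // => a b /eqP.
    by rewrite eqr_nat eqSS => /eqP.
  have := max_poly_roots qn0 rs_root rs_uniq.
  by rewrite size_map size_iota ltnn.
apply/mpolyP => m; rewrite mcoeff0; apply/eqP; apply: contraT => nz.
have mp : m \in msupp p by rewrite mcoeff_msupp.
have : q`_(phi m) = 0 by rewrite q0 coef0.
rewrite /q coef_sum (bigD1_seq m) //= ?msupp_uniq //.
rewrite coefZ coefXn eqxx mulr1 big_seq_cond big1 ?addr0; first by move/eqP; rewrite (negbTE nz).
move=> m' /andP[m'p ne]; rewrite coefZ coefXn; case: eqP => [/phi_inj e|_]; last by rewrite mulr0.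
by rewrite e ?eqxx in ne.
Qed.

(** * Bases and traces *)

Section Bases.
Variables (K : fieldType) (V : lmodType K).

Definition spanned m (e : 'I_m -> V) (v : V) : Prop :=
  exists c : 'rV[K]_m, v = \sum_i c 0 i *: e i.

Lemma spanned_mem m (e : 'I_m -> V) i : spanned e (e i).
Proof.
exists (delta_mx 0 i); rewrite (bigD1 i) //= mxE !eqxx scale1r big1 ?addr0 //.
by move=> j ne; rewrite mxE (negbTE ne) andbF scale0r.
Qed.

Lemma spanned_lincomb m (e : 'I_m -> V) p (v : 'I_p -> V) (a : 'I_p -> K) :
  (forall k, spanned e (v k)) -> spanned e (\sum_k a k *: v k).
Proof.
move=> ev; have [c cE] : exists c : 'I_p -> 'rV[K]_m,
    forall k, v k = \sum_i c k 0 i *: e i.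
  by exists (fun k => proj1_sig (constructive_indefinite_description _ (ev k))) => k;
    case: constructive_indefinite_description.
exists (\sum_k a k *: c k).
under eq_bigr do rewrite cE scaler_sumr.
rewrite exchange_big; apply: eq_bigr => i _ /=.
rewrite summxE scaler_suml; apply: eq_bigr => k _.
by rewrite mxE scalerA.
Qed.

(** Greedy extraction from the tail: [x] is kept when [g x] is not yet spanned. Indices are selected
    rather than vectors, so that a basis vector later remembers its diagram. *)
Lemma exists_basis_seq (I : eqType) (g : I -> V) (s : seq I) :
  exists m (k : 'I_m -> I), [/\ forall i, k i \in s,
    forall i, i \in s -> spanned (g \o k) (g i)
    & forall c : 'rV[K]_m, \sum_i c 0 i *: g (k i) = 0 -> c = 0].
Proof.
elim: s => [|x s [m [k [ks span_k free_k]]]].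
  exists 0%N, (fun i : 'I_0 => match notF (ltn_ord i) with end).
  by split=> [[]|//|c _] //; apply/rowP=> -[].
have [xk|xk] := classic (spanned (g \o k) (g x)).
  exists m, k; split=> // i; first by rewrite in_cons ks orbT.
  by rewrite in_cons => /predU1P[->|/span_k].
pose k' (i : 'I_m.+1) := if unlift ord0 i is Some j then k j else x.
have k'0 : k' ord0 = x by rewrite /k' unlift_none.
have k'S j : k' (lift ord0 j) = k j by rewrite /k' liftK.
exists m.+1, k'; split=> [i|i|c].
- by case: (unliftP ord0 i) => [j ->|->]; rewrite ?k'0 ?k'S in_cons ?ks ?orbT ?eqxx.
- rewrite in_cons => /predU1P[->|/span_k[c ->]].
    by rewrite -k'0; apply: (spanned_mem (g \o k')).
  apply: spanned_lincomb => j; rewrite -[(g \o k) j]/(g (k j)) -k'S.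
  exact: (spanned_mem (g \o k')).
rewrite big_ord_recl k'0; under eq_bigr do rewrite k'S.
(* Otherwise dividing by this coefficient would put [g x] in the span of the vectors already
   kept. *)
move=> c_eq0; have c0 : c 0 ord0 = 0.
  apply/eqP/negPn/negP => c0; apply: xk.
  exists (\row_j (- (c 0 ord0)^-1 * c 0 (lift ord0 j))).
  apply: (scalerI c0); rewrite -[LHS]opprK (addr0_eq c_eq0) scaler_sumr -sumrN.
  apply: eq_bigr => j _; rewrite mxE scalerA mulNr mulrN mulrA mulfV //.
  by rewrite mul1r scaleNr.
move: c_eq0; rewrite c0 scale0r add0r => c_eq0.
have cS : \row_j c 0 (lift ord0 j) = 0.
  by apply: free_k; rewrite -[RHS]c_eq0; apply: eq_bigr => j _; rewrite mxE.
apply/rowP=> i; rewrite mxE; case: (unliftP ord0 i) => [j ->|-> //].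
by have := congr1 (fun v : 'rV_m => v 0 j) cS; rewrite !mxE.
Qed.

Lemma exists_basis_of_span (I : finType) (P : pred I) (g : I -> V) :
  exists m (k : 'I_m -> I), (forall i, P (k i)) /\
    is_basis (lin_span (fun v => exists2 i, P i & v = g i)) (g \o k).
Proof.
have [m [k [kP span_k free_k]]] := exists_basis_seq g (enum P).
exists m, k; split=> [i|]; first by have := kP i; rewrite mem_enum.
split=> [i|v [p [s [a [sP ->]]]]].
  exists 1%N, (fun=> g (k i)), (fun=> 1); split.
    by move=> _; exists (k i); first by have := kP i; rewrite mem_enum.
  by rewrite big_ord1 scale1r.
have [|c cE] := spanned_lincomb (e := g \o k) (v := s) a.
  by move=> j; have [i Pi ->] := sP j; apply: span_k; rewrite mem_enum.
exists c; split=> // c' c'E; apply/eqP; rewrite -subr_eq0; apply/eqP/free_k.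
under eq_bigr do rewrite !mxE scalerBl.
by rewrite sumrB /= -[X in X - _]cE -[X in _ - X]c'E subrr.
Qed.

(** [W] is an arbitrary predicate, so uniqueness of coordinates cannot be invoked at 0. It is
    invoked at [e ord0], whose coordinates [d] could be replaced by [d + c]. *)
Lemma is_basis_free (W : V -> Prop) m (e : 'I_m -> V) (c : 'rV[K]_m) :
  is_basis W e -> \sum_i c 0 i *: e i = 0 -> c = 0.
Proof.
case=> We eP c0; case: m e We eP c c0 => [|m] e We eP c c0.
  by apply/rowP=> -[].
have [d [dE ud]] := eP _ (We ord0).
apply: (addrI d); rewrite addr0; symmetry; apply: ud; rewrite dE.
by under [RHS]eq_bigr do rewrite mxE scalerDl; rewrite big_split /= c0 addr0.
Qed.

(** With change-of-basis matrices [P] and [Q], a priori rectangular, [PQ = 1] and [A' = QAP], hence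
    [tr A' = tr (PQA) = tr A]. *)
Lemma is_trace_unique (W : V -> Prop) (f : {linear V -> V}) (t t' : K) :
  is_trace W f t -> is_trace W f t' -> t = t'.
Proof.
move=> [m [e [A [[We eP] fe ->]]]] [m' [e' [A' [[We' e'P] fe' ->]]]].
have coords p q (u : 'I_p -> V) (v : 'I_q -> V) : (forall i, W (u i)) ->
    (forall w, W w -> exists! c : 'rV[K]_q, w = \sum_i c 0 i *: v i) ->
    exists P : 'M[K]_(p, q), forall i, u i = \sum_j P i j *: v j.
  move=> Wu vP; have uv i : exists c : 'rV[K]_q, u i = \sum_j c 0 j *: v j.
    by have [c []] := vP _ (Wu i); exists c.
  exists (\matrix_(i, j) proj1_sig (constructive_indefinite_description _ (uv i)) 0 j) => i.
  under eq_bigr do rewrite mxE.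
  by case: constructive_indefinite_description.
have compose p q r (P : 'M[K]_(p, q)) (Q : 'M[K]_(q, r)) (v : 'I_r -> V) i :
    \sum_j P i j *: (\sum_l Q j l *: v l) = \sum_l (P *m Q) i l *: v l.
  under eq_bigr do rewrite scaler_sumr.
  rewrite exchange_big; apply: eq_bigr => l _.
  by rewrite mxE scaler_suml; apply: eq_bigr => j _; rewrite scalerA.
have uniq_coords p q (v : 'I_q -> V) (P Q : 'M[K]_(p, q)) : is_basis W v ->
    (forall i, \sum_j P i j *: v j = \sum_j Q i j *: v j) -> P = Q.
  move=> basis_v PQ; apply/row_matrixP => i; apply/eqP.
  rewrite -subr_eq0; apply/eqP/(is_basis_free basis_v).
  under eq_bigr do rewrite !mxE scalerBl.
  by rewrite sumrB /= PQ subrr.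
have [P eE] := coords _ _ _ _ We e'P.
have [Q e'E] := coords _ _ _ _ We' eP.
have PQ : P *m Q = 1%:M.
  apply: (uniq_coords _ _ e) => // i; rewrite -compose.
  under eq_bigr do rewrite -e'E.
  rewrite -eE (bigD1 i) //= mxE eqxx scale1r big1 ?addr0 // => j ne.
  by rewrite mxE eq_sym (negbTE ne) scale0r.
have AE : A' = Q *m A *m P.
  apply: (uniq_coords _ _ e') => // i; rewrite -fe' e'E linear_sum.
  under eq_bigr do rewrite linearZ /= fe.
  by rewrite compose -[RHS]compose; apply: eq_bigr => j _; rewrite -eE.
by rewrite AE mxtrace_mulC mulmxA PQ mul1mx.
Qed.
End Bases.

(** * The dual character as a sum of weights *)

Definition row_weight n (C : diagram n) : 'X_{1..n} := [multinom #|[set j | (i, j) \in C]| | i < n].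

Section FlaggedWeylModule.
Variables (K : numFieldType) (n : nat).
Implicit Types (C D : diagram n) (R S : {set 'I_n}) (x : 'I_n -> K).

Definition torus x : 'M[K]_n := diag_mx (\row_i (x i)^-1).

Lemma set_le_card R S : set_le R S -> #|R| = #|S|.
Proof. by rewrite /set_le all2E !cardE => /andP[/eqP]. Qed.

Lemma set_le_enum_val R S (eqRS : #|R| = #|S|) (t : 'I_#|R|) :
  set_le R S -> (enum_val t <= enum_val (cast_ord eqRS t))%N.
Proof.
rewrite /set_le all2E => /andP[/eqP sz /allP/= le].
have [i0 _] : exists i0 : 'I_n, true by exists (enum_val t).
rewrite !(enum_val_nth i0) /=.
have tR : (t < size (enum R))%N by rewrite -cardE.
have := le (nth i0 (enum R) t, nth i0 (enum S) t); apply.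
by rewrite -nth_zip // mem_nth // size_zip -sz minnn.
Qed.

Lemma minorYE R S (eqRS : #|R| = #|S|) :
  minorY K R S =
  \det (\matrix_(a < #|R|, b < #|R|) matY K n (enum_val a) (enum_val (cast_ord eqRS b))).
Proof.
rewrite /minorY.
have -> : submatY K R S = castmx (erefl, eqRS)
    (\matrix_(a < #|R|, b < #|R|) matY K n (enum_val a) (enum_val (cast_ord eqRS b))).
  apply/matrixP => a b; rewrite castmxE !mxE /= cast_ord_id.
  by rewrite cast_ordKV.
move: (\matrix_(a, b) _) => M.
by case: _ / eqRS; rewrite castmx_id conform_mx_id.
Qed.

Lemma minorY_neq0 R S : set_le R S -> minorY K R S != 0.
Proof.
move=> leRS; have eqRS := set_le_card leRS; rewrite (minorYE eqRS).
(* At this point the submatrix evaluates to the identity. *)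
pose v (k : 'I_#|utri n|) : K :=
  [exists t : 'I_#|R|, val (enum_val k) == (enum_val t, enum_val (cast_ord eqRS t))]%:R.
apply: contraTneq isT => det0.
have /eqP := congr1 (meval v) det0; rewrite -det_map_mx rmorph0.
suff -> : map_mx (meval v) (\matrix_(a < #|R|, b < #|R|)
    matY K n (enum_val a) (enum_val (cast_ord eqRS b))) = 1%:M by rewrite det1 oner_eq0.
apply/matrixP => a b; rewrite !mxE.
case: insubP => [u _ uE | ].
  rewrite mevalXU /v enum_rankK uE; congr (nat_of_bool _)%:R.
  apply/existsP/eqP => [[t /eqP[/enum_val_inj -> /enum_val_inj/cast_ord_inj -> //]]|->].
  by exists b.
(* An entry strictly below the diagonal of [Y] is 0; [R <= S] keeps such entries off the diagonal of
   the submatrix. *)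
rewrite rmorph0 /= -ltnNge => lt_ba; case: eqP => // ab; move: lt_ba.
by rewrite ab ltnNge set_le_enum_val.
Qed.

Lemma detY_neq0 C D : diagram_le C D -> detY K C D != 0.
Proof.
by move=> /forallP leCD; apply/prodf_neq0 => j _; apply: minorY_neq0.
Qed.

Lemma invmx_torus x : (forall i, x i != 0) -> invmx (torus x) = diag_mx (\row_i x i).
Proof.
move=> xn0; have VK : diag_mx (\row_i x i) *m torus x = 1%:M.
  rewrite mulmx_diag -diag_const_mx; congr diag_mx.
  by apply/rowP=> i; rewrite !mxE mulfV.
by rewrite -[LHS]mul1mx -VK mulmxK // (mulmx1_unit VK).2.
Qed.

(** Two inverses cancel: [act] substitutes [b^-1 Y], and [torus x] has diagonal entries [x_i^-1]. *)
Lemma act_matY x i j : (forall i, x i != 0) ->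
  act (matY K n i j) (torus x) = x i *: matY K n i j.
Proof.
move=> xn0; rewrite /act mxE.
case: insubP => [u _ uE|]; last by rewrite comp_mpoly0 scaler0.
rewrite comp_mpolyXU -tnth_nth tnth_mktuple enum_rankK uE /=.
rewrite invmx_torus // map_diag_mx mul_diag_mx !mxE mul_mpolyC -uE valK.
by congr (_ *: _); rewrite uE.
Qed.

Lemma act_minorY x R S : (forall i, x i != 0) -> #|R| = #|S| ->
  act (minorY K R S) (torus x) = (\prod_(i in R) x i) *: minorY K R S.
Proof.
move=> xn0 eqRS; rewrite (minorYE eqRS).
set M := \matrix_(a, b) _.
have -> : act (\det M) (torus x) = \det (diag_mx (\row_a (x (enum_val a))%:MP) *m M).
  rewrite /act -det_map_mx; congr (\det _); apply/matrixP => a b.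
  have := act_matY (enum_val a) (enum_val (cast_ord eqRS b)) xn0.
  by rewrite mul_diag_mx !mxE mul_mpolyC.
rewrite det_mulmx det_diag -mul_mpolyC; congr (_ * _).
rewrite [in RHS]big_enum_val rmorph_prod.
by apply: eq_bigr => a _; rewrite mxE.
Qed.

(** Column [j] contributes the product of the [x_i] over its boxes; regrouping by rows gives the
    exponents [row_weight C i]. *)
Lemma act_detY x C D : (forall i, x i != 0) -> diagram_le C D ->
  act (detY K C D) (torus x) = (\prod_i x i ^+ row_weight C i) *: detY K C D.
Proof.
move=> xn0 /forallP leCD; rewrite /act /detY rmorph_prod /=.
rewrite (eq_bigr (fun j => (\prod_(i in dcol C j) x i) *: minorY K (dcol C j) (dcol D j))).
  rewrite scaler_prod; congr (_ *: _).
  under [RHS]eq_bigr do rewrite mnmE -prodr_const.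
  rewrite (exchange_big_dep predT) //=.
  by apply: eq_bigr => i _; apply: eq_bigl => j; rewrite !inE.
by move=> j _; rewrite -[LHS]/(act _ (torus x)) act_minorY // (set_le_card (leCD j)).
Qed.

Definition weyl_character D (chi : {mpoly K[n]}) : Prop :=
  exists m (C : 'I_m -> diagram n), (forall k, diagram_le (C k) D) /\
    is_basis (weyl_module (K:=K) D) (fun k => detY K (C k) D) /\
    chi = \sum_k 'X_[row_weight (C k)].

Lemma weyl_character_is_dual_character D chi :
  weyl_character D chi -> is_dual_character D chi.
Proof.
move=> [m [C [leCD [basis ->]]]] x xn0.
exists m, (fun k => detY K (C k) D), (diag_mx (\row_k \prod_i x i ^+ row_weight (C k) i)).
split=> // [k|].
  rewrite act_detY // [RHS](bigD1 k) //= !mxE eqxx mulr1n [X in _ + X]big1 ?addr0 // => j ne.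
  by rewrite !mxE eq_sym (negbTE ne) scale0r.
rewrite mxtrace_diag rmorph_sum; apply: eq_bigr => k _.
by rewrite /= mevalX mxE.
Qed.

(** A basis chosen among the minors diagonalises the torus, so some polynomial meets the
    specification and [epsilon] does too. Uniqueness of the trace makes the two agree on the torus,
    hence everywhere. *)
Lemma dual_characterP D : weyl_character D (dual_character K D).
Proof.
have [m [C [leCD basis]]] :=
  exists_basis_of_span (fun C : diagram n => diagram_le C D) (fun C => detY K C D).
have dualchi : is_dual_character D (\sum_k 'X_[row_weight (C k)] : {mpoly K[n]}).
  by apply: weyl_character_is_dual_character; exists m, C.
exists m, C; split=> //; split=> //; apply/eqP; rewrite -subr_eq0; apply/eqP.
apply: mpoly_eq0_torus => x xn0; rewrite rmorphB /=; apply/eqP; rewrite subr_eq0; apply/eqP.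
have := epsilon_spec (inhabits 0) (@is_dual_character K n D) (ex_intro _ _ dualchi).
move=> /(_ x xn0) tr1; have tr2 := dualchi x xn0.
exact: (is_trace_unique (f := comp_mpoly _) tr1 tr2).
Qed.

(** The nonzero vector [detY K C D] involves some basis vector [detY K (B k) D], and eigenvectors of
    distinct weights are independent, so the two weights agree. *)
Lemma row_weight_msupp C D :
  diagram_le C D -> row_weight C \in msupp (dual_character K D).
Proof.
move=> leCD; have [m [B [leBD [basis ->]]]] := dual_characterP D.
have [c [cE _]] : exists! c : 'rV[K]_m, detY K C D = \sum_k c 0 k *: detY K (B k) D.
  apply: (proj2 basis); exists 1%N, (fun=> detY K C D), (fun=> 1).
  by split; [exists C | rewrite big_ord1 scale1r].
have [k ck] : exists k, c 0 k != 0.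
  apply/existsP; apply: contraTT (detY_neq0 leCD) => /existsPn/= c0.
  rewrite cE big1 ?eqxx // => k _.
  by have /negPn/eqP -> := c0 k; rewrite scale0r.
have wE : row_weight C = row_weight (B k).
  (* At this torus point a vector of weight [w] has eigenvalue [2 ^ w_i], which determines [w_i]. *)
  apply/mnmP => i; pose x (i' : 'I_n) : K := if i' == i then 2 else 1.
  have xn0 i' : x i' != 0 by rewrite /x; case: ifP; rewrite ?pnatr_eq0 ?oner_eq0.
  have xw (w : 'X_{1..n}) : \prod_i' x i' ^+ w i' = 2 ^+ w i.
    rewrite (bigD1 i) //= /x eqxx big1 ?mulr1 // => i' /negbTE ->.
    by rewrite expr1n.
  (* The difference of two expansions of the image of [detY K C D]: by its own eigenvalue, and term
     by term. *)
  pose c' := \row_k (c 0 k * (2 ^+ row_weight C i - 2 ^+ row_weight (B k) i)) : 'rV[K]_m.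
  have /rowP/(_ k) : c' = 0.
    apply: (is_basis_free basis); rewrite /c'.
    under eq_bigr do rewrite mxE mulrBr scalerBl.
    rewrite sumrB.
    have := act_detY xn0 leCD; rewrite xw {1}cE.
    rewrite /act linear_sum /=.
    under eq_bigr => k' _.
      rewrite linearZ /= -[X in _ *: X]/(act _ (torus x)) act_detY // xw scalerA.
      over.
    have -> : \sum_j (c 0 j * 2 ^+ row_weight C i) *: detY K (B j) D =
        2 ^+ row_weight C i *: detY K C D.
      by rewrite cE scaler_sumr; apply: eq_bigr => j _; rewrite scalerA mulrC.
    by move=> <-; apply/eqP; rewrite subr_eq0; apply/eqP.
  rewrite !mxE => /eqP; rewrite mulf_eq0 (negbTE ck) /= subr_eq0.
  rewrite -!natrX eqr_nat => /eqP/eqP; rewrite eqn_exp2l //.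
  by move/eqP.
(* The coefficient counts the basis vectors of this weight, so nothing cancels in characteristic
   0. *)
rewrite mcoeff_msupp raddf_sum /=.
under eq_bigr do rewrite mcoeffX.
rewrite -natr_sum pnatr_eq0 sum_nat_eq0; apply/forallPn; exists k.
by rewrite wE eqxx.
Qed.

End FlaggedWeylModule.

(** * Moving boxes up *)

Section Diagrams.
Variable n : nat.
Implicit Types (C D : diagram n) (R S : {set 'I_n}).

Let leo (r s : 'I_n) := (r <= s)%N.

Lemma sorted_enum_ord S : sorted leo (enum S).
Proof.
rewrite /enum_mem; apply: sorted_filter; first by move=> ? ? ?; apply: leq_trans.
by have := iota_sorted 0 n; rewrite -val_enum_ord sorted_map enumT.
Qed.

(** If [y < x] for the heads, the threshold [y.+1] counts [y] but nothing in [s]. For the tails, a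
    threshold above [y] counts both heads, and a lower one counts nothing in [t]. *)
Lemma all2_of_count (s t : seq 'I_n) : sorted leo s -> sorted leo t ->
  size s = size t ->
  (forall m, count (fun i : 'I_n => i < m) t <= count (fun i : 'I_n => i < m) s)%N ->
  all2 leo s t.
Proof.
have leo_trans : transitive leo by move=> ? ? ?; apply: leq_trans.
elim: s t => [|x s IHs] [|y t] //= sort_s sort_t [sz] cnt.
have le_s : all (leo x) s by apply: order_path_min sort_s.
have le_t : all (leo y) t by apply: order_path_min sort_t.
have le_xy : (x <= y)%N.
  rewrite leqNgt; apply/negP => lt_yx; have := cnt y.+1.
  rewrite ltnSn (_ : (x < y.+1)%N = false); last by rewrite ltnS leqNgt lt_yx.
  rewrite add0n => /(leq_trans (leq_addr _ _)); rewrite -has_count.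
  move=> /hasP[z zs le_zy]; have := allP le_s _ zs.
  by rewrite /leo leqNgt (leq_ltn_trans _ lt_yx).
rewrite /leo le_xy IHs ?(path_sorted sort_s) ?(path_sorted sort_t) // => m.
have [lt_ym|le_my] := ltnP y m.
  by have := cnt m; rewrite lt_ym (leq_ltn_trans le_xy lt_ym) leq_add2l.
rewrite (eqP (_ : count _ t == 0)) // -leqn0 leqNgt -has_count.
apply/hasPn => z zt; rewrite -leqNgt (leq_trans le_my) //; exact: (allP le_t).
Qed.

Lemma set_le_refl S : set_le S S.
Proof. by rewrite /set_le; elim: (enum S) => //= x s ->; rewrite leqnn. Qed.

Lemma set_le_trans : transitive (@set_le n).
Proof.
move=> S R T; rewrite /set_le.
elim: (enum R) (enum S) (enum T) => [|r s IHs] [|s0 s'] [|t0 t] //=.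
by move=> /andP[le1 all1] /andP[le2 all2]; rewrite (leq_trans le1 le2) (IHs s').
Qed.

(** Counting below thresholds ignores order, so there is no need to locate [a] and [b] in the
    enumerations: trading [b] for a smaller [a] can only raise the counts. *)
Lemma set_le_replace S (a b : 'I_n) : (a < b)%N -> a \notin S -> b \in S ->
  set_le (a |: S :\ b) S.
Proof.
move=> lt_ab aS bS.
have permR : perm_eq (enum (a |: S :\ b)) (a :: enum (S :\ b)).
  apply: uniq_perm; rewrite /= ?enum_uniq ?mem_enum ?inE ?(negbTE aS) ?andbF //.
  by move=> i; rewrite !(inE, mem_enum).
have permS : perm_eq (enum S) (b :: enum (S :\ b)).
  apply: uniq_perm; rewrite /= ?enum_uniq ?mem_enum ?inE ?eqxx //.
  by move=> i; rewrite !(inE, mem_enum); case: eqP => [->|].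
apply: all2_of_count; rewrite ?sorted_enum_ord //.
  by rewrite (perm_size permR) (perm_size permS).
move=> m; rewrite (seq.permP permR) (seq.permP permS) /= leq_add2r.
by case: (ltnP b m) => // lt_bm; rewrite (ltn_trans lt_ab lt_bm).
Qed.

Lemma diagram_le_refl D : diagram_le D D.
Proof. by apply/forallP => j; apply: set_le_refl. Qed.

Lemma diagram_le_trans : transitive (@diagram_le n).
Proof.
move=> C B D /forallP BC /forallP CD; apply/forallP => j.
exact: set_le_trans (BC j) (CD j).
Qed.

Definition movable D (a b : 'I_n) : pred 'I_n :=
  fun j => ((a, j) \notin D) && ((b, j) \in D).

(** A swap of rows [a] and [b] in the columns of [J]; in a movable column it takes the box of row
    [b] up to row [a]. *)
Definition move D (a b : 'I_n) (J : {set 'I_n}) : diagram n :=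
  [set p | (if p.2 \in J then tperm a b p.1 else p.1, p.2) \in D].

Lemma mem_move D a b (J : {set 'I_n}) i j :
  ((i, j) \in move D a b J) = ((if j \in J then tperm a b i else i, j) \in D).
Proof. by rewrite inE. Qed.

Lemma move_le D (a b : 'I_n) (J : {set 'I_n}) : (a < b)%N -> {in J, forall j, movable D a b j} ->
  diagram_le (move D a b J) D.
Proof.
move=> lt_ab mvJ; apply/forallP => j; have [jJ|jJ] := boolP (j \in J); last first.
  rewrite (_ : dcol (move D a b J) j = dcol D j) ?set_le_refl //.
  by apply/setP=> i; rewrite !inE /= (negbTE jJ).
have /andP[aD bD] := mvJ j jJ.
rewrite (_ : dcol _ j = a |: dcol D j :\ b) ?set_le_replace ?inE //.
apply/setP=> i; rewrite !inE /= jJ.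
have neq_ab : a != b by rewrite -val_eqE ltn_eqF.
case: tpermP => [->|->|/eqP/negbTE -> /eqP/negbTE -> //]; first by rewrite eqxx bD.
by rewrite eqxx eq_sym (negbTE neq_ab) (negbTE aD).
Qed.

Definition ifeq (i a : 'I_n) (k : nat) : nat := if i == a then k else 0.

(** Row [a] gains exactly the columns of [J], all empty there before, and row [b] loses them. *)
Lemma row_weight_move D (a b : 'I_n) (J : {set 'I_n}) : (a < b)%N ->
  {in J, forall j, movable D a b j} ->
  forall i, (row_weight (move D a b J) i + ifeq i b #|J| = row_weight D i + ifeq i a #|J|)%N.
Proof.
move=> lt_ab mvJ i; rewrite !mnmE /ifeq.
have neq_ab : a != b by rewrite -val_eqE ltn_eqF.
have [->|ia] := eqVneq i a.
  rewrite (negbTE neq_ab) addn0 -cardsUI (_ : [set j | (a, j) \in D] :&: J = set0).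
    rewrite cards0 addn0; congr #|pred_of_set _|; apply/setP => j; rewrite !inE /=.
    by case: ifP => [/mvJ/andP[_]|]; rewrite ?tpermL ?orbT ?orbF.
  apply/setP => j; rewrite !inE; apply/negP => /andP[aD /mvJ/andP[]].
  by rewrite aD.
have [->|ib] := eqVneq i b; last first.
  rewrite !addn0; congr #|pred_of_set _|; apply/setP => j; rewrite !inE /=.
  by rewrite tpermD 1?eq_sym //; case: ifP.
rewrite addn0 -cardsUI (_ : [set j | (b, j) \in move D a b J] :&: J = set0).
  rewrite cards0 addn0; congr #|pred_of_set _|; apply/setP => j; rewrite !inE /=.
  by case: ifP => [/mvJ/andP[_ ->]|]; rewrite ?orbT ?orbF.
apply/setP => j; rewrite !inE; apply/negP => /andP[aD jJ]; move: aD.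
by rewrite jJ tpermR; have /andP[/negbTE->] := mvJ j jJ.
Qed.

(* A movable column j is encoded by the rank [#|initial P j|]: moving boxes in
   all movable columns up to j puts that rank into the weight. *)
Definition initial (P : pred 'I_n) (j : 'I_n) : {set 'I_n} :=
  [set j' : 'I_n | (j' <= j)%N & P j'].

Lemma mem_initial (P : pred 'I_n) j : P j -> j \in initial P j.
Proof. by move=> Pj; rewrite inE leqnn. Qed.

Lemma card_initial_gt0 (P : pred 'I_n) j : P j -> (0 < #|initial P j|)%N.
Proof. by move=> Pj; apply/card_gt0P; exists j; apply: mem_initial. Qed.

(** Initial sets are nested, so equal cardinals make them equal, and each contains its own last
    column. *)
Lemma card_initial_inj (P : pred 'I_n) j j' : P j -> P j' ->
  #|initial P j| = #|initial P j'| -> j = j'.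
Proof.
wlog le_jj' : j j' / (j <= j')%N.
  move=> wlog_le Pj Pj' eq_card; have [le|le] := leqP j j'; first exact: wlog_le.
  by apply/esym/wlog_le; rewrite // ltnW.
move=> Pj Pj' eq_card; apply/val_inj/eqP; rewrite eqn_leq le_jj' /=.
have /eqP eqJ : initial P j == initial P j'.
  rewrite eqEcard eq_card leqnn andbT; apply/subsetP => i; rewrite !inE.
  by move=> /andP[le_ij ->]; rewrite (leq_trans le_ij).
by have := mem_initial Pj'; rewrite -eqJ inE => /andP[].
Qed.

(** * Comparing two weights *)

Definition increased (v w : 'X_{1..n}) : {set 'I_n} := [set i | v i < w i]%N.

(** The Hamming distance between the two exponent vectors. *)
Definition discrepancy (v w : 'X_{1..n}) : nat :=
  (#|increased v w| + #|increased w v|)%N.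

(** [w = v + k(e_a - e_b)], with the negative term carried across to avoid truncated subtraction. *)
Definition shift1 (v w : 'X_{1..n}) a b k : Prop :=
  forall i, (w i + ifeq i b k = v i + ifeq i a k)%N.

Definition shift2 (v w : 'X_{1..n}) a b k c d l : Prop :=
  forall i, (w i + (ifeq i b k + ifeq i d l) = v i + (ifeq i a k + ifeq i c l))%N.

Lemma shift1P v w a b k : a != b -> (0 < k)%N -> shift1 v w a b k ->
  [/\ increased v w = [set a], increased w v = [set b] & v b = (w b + k)%N].
Proof.
move=> ab k0 vw; split; last by have := vw b; rewrite /ifeq eqxx eq_sym (negbTE ab) addn0.
  apply/setP=> i; rewrite !inE; have := vw i; rewrite /ifeq.
  by case: (eqVneq i a) => [->|_]; rewrite ?(negbTE ab); [|case: ifP]; lia.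
apply/setP=> i; rewrite !inE; have := vw i; rewrite /ifeq.
by case: (eqVneq i b) => [->|_]; rewrite 1?eq_sym ?(negbTE ab); [|case: ifP]; lia.
Qed.

(** The sources [b] and [d] are distinct, so each multiplicity is read off at its own source; the
    targets [a] and [c] may coincide, as they do for [r2]. *)
Lemma shift2P v w a b k c d l : (0 < k)%N -> (0 < l)%N ->
  b != d -> a \notin [set b; d] -> c \notin [set b; d] -> shift2 v w a b k c d l ->
  [/\ increased v w = [set a; c], increased w v = [set b; d],
      v b = (w b + k)%N & v d = (w d + l)%N].
Proof.
move=> k0 l0 bd; rewrite !inE !negb_or => /andP[ab ad] /andP[cb cd] vw; split.
- apply/setP=> i; rewrite !inE; have := vw i; rewrite /ifeq.
  case: (eqVneq i a) => [->|_]; first by rewrite (negbTE ab) (negbTE ad); case: ifP; lia.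
  case: (eqVneq i c) => [->|_]; first by rewrite (negbTE cb) (negbTE cd); lia.
  by do 2 case: ifP; lia.
- apply/setP=> i; rewrite !inE; have := vw i; rewrite /ifeq.
  case: (eqVneq i b) => [->|_].
    by rewrite ![b == _]eq_sym (negbTE ab) (negbTE cb); case: ifP; lia.
  case: (eqVneq i d) => [->|_]; first by rewrite ![d == _]eq_sym (negbTE ad) (negbTE cd); lia.
  by do 2 case: ifP; lia.
- have := vw b; rewrite /ifeq eqxx (negbTE bd) ![b == _]eq_sym (negbTE ab) (negbTE cb); lia.
have := vw d; rewrite /ifeq eqxx ![d == _]eq_sym (negbTE bd) (negbTE ad) (negbTE cd); lia.
Qed.

Lemma set2_ord_inj (a b a' b' : 'I_n) : (a < b)%N -> (a' < b')%N ->
  [set a; b] = [set a'; b'] -> a = a' /\ b = b'.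
Proof.
move=> ab ab' eqS.
have ha : a \in [set a'; b'] by rewrite -eqS !inE eqxx.
have hb : b \in [set a'; b'] by rewrite -eqS !inE eqxx orbT.
have ha' : a' \in [set a; b] by rewrite eqS !inE eqxx.
move: ha hb ha'; rewrite !inE -!val_eqE /= => ha hb ha'.
by split; apply/val_inj => /=; lia.
Qed.

(** Moves in disjoint columns or disjoint rows do not interfere: the first leaves the columns of
    [J2] movable for the second. *)
Lemma move2 D (a b c d : 'I_n) (J1 J2 : {set 'I_n}) : (a < b)%N -> (c < d)%N ->
  {in J1, forall j, movable D a b j} -> {in J2, forall j, movable D c d j} ->
  {in J2, forall j, j \notin J1} \/ [disjoint [set a; b] & [set c; d]] ->
  diagram_le (move (move D a b J1) c d J2) D /\
  shift2 (row_weight D) (row_weight (move (move D a b J1) c d J2)) a b #|J1| c d #|J2|.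
Proof.
move=> ab cd mv1 mv2 dis.
have mv2' : {in J2, forall j, movable (move D a b J1) c d j}.
  move=> j jJ2; have := mv2 j jJ2; rewrite /movable !mem_move.
  case: ifP => // jJ1; case: dis => [/(_ j jJ2)|]; first by rewrite jJ1.
  move=> dis; rewrite !tpermD //; apply: contraTneq dis => e; apply/pred0Pn.
  - by exists a; rewrite /= e !inE eqxx ?orbT.
  - by exists b; rewrite /= e !inE eqxx ?orbT.
  - by exists a; rewrite /= e !inE eqxx ?orbT.
  by exists b; rewrite /= e !inE eqxx ?orbT.
split; first exact: diagram_le_trans (move_le cd mv2') (move_le ab mv1).
move=> i; have := row_weight_move ab mv1 i; have := row_weight_move cd mv2' i; lia.
Qed.

End Diagrams.

(** * Counting weights *)

Section Counting.
Variables (n : nat) (D : diagram n) (W : seq 'X_{1..n}).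
Hypothesis W_weights : forall C, diagram_le C D -> row_weight C \in W.

Let wD := row_weight D.
Let at_discrepancy m := count (fun w => discrepancy wD w == m) W.

(** The common scheme of the counts below: configurations inject into the weights of [W] at a fixed
    distance from [wD]. *)
Lemma card_le_at_discrepancy (T : finType) (A : {set T}) (f : T -> diagram n) m :
  {in A &, injective (fun t => row_weight (f t))} ->
  (forall t, t \in A -> diagram_le (f t) D /\ discrepancy wD (row_weight (f t)) = m) ->
  (#|A| <= at_discrepancy m)%N.
Proof.
move=> f_inj fA; rewrite /at_discrepancy -size_filter cardE.
rewrite -(size_map (fun t => row_weight (f t))).
apply: uniq_leq_size => [|_ /mapP[t tA ->]].
  rewrite map_inj_in_uniq ?enum_uniq // => t t'; rewrite !mem_enum; exact: f_inj.
move: tA; rewrite mem_enum => /fA[leD dis].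
by rewrite mem_filter dis eqxx W_weights.
Qed.

(** The weight of [D] itself accounts for the summand 1 of the bound. *)
Lemma le1_at_discrepancy0 : (1 <= at_discrepancy 0)%N.
Proof.
rewrite -[X in (X <= _)%N](@cards1 _ tt).
apply: (@card_le_at_discrepancy _ _ (fun=> D)) => [[] []|_ _] //.
rewrite diagram_le_refl; split=> //; apply/eqP.
by rewrite addn_eq0 !cards_eq0; apply/andP; split; apply/eqP/setP => i; rewrite !inE ltnn.
Qed.

Lemma r1_le_at_discrepancy2 : (r1 D <= at_discrepancy 2)%N.
Proof.
pose A := [set t : 'I_n * 'I_n * 'I_n |
  let: (i1, i2, j) := t in (i1 < i2)%N && movable D i1 i2 j].
pose F (t : 'I_n * 'I_n * 'I_n) : {set box n} :=
  let: (i1, i2, j) := t in [set (i1, j); (i2, j)].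
(* Every counted box set is the image under [F] of a tuple in [A], so it suffices to bound the
   number of tuples. *)
have le_A : (r1 D <= #|A|)%N.
  apply: leq_trans (leq_imset_card F A); apply/subset_leq_card/subsetP => E.
  rewrite inE => /existsP[i1 /existsP[i2 /existsP[j /and4P[lt12 D1 D2 /eqP->]]]].
  by apply/imsetP; exists (i1, i2, j) => //; rewrite inE lt12 /movable D1.
apply: leq_trans le_A _.
pose J (t : 'I_n * 'I_n * 'I_n) := let: (i1, i2, j) := t in initial (movable D i1 i2) j.
pose f (t : 'I_n * 'I_n * 'I_n) := let: (i1, i2, j) := t in move D i1 i2 (J t).
have fP i1 i2 j : (i1, i2, j) \in A -> let w := row_weight (f (i1, i2, j)) in
    [/\ movable D i1 i2 j, diagram_le (f (i1, i2, j)) D &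
    [/\ increased wD w = [set i1], increased w wD = [set i2] & wD i2 = w i2 + #|J (i1, i2, j)|]%N].
  rewrite inE => /andP[lt12 mv].
  have mvJ : {in J (i1, i2, j), forall j', movable D i1 i2 j'}.
    by move=> j'; rewrite inE => /andP[].
  split=> //; first exact: move_le.
  apply: shift1P; rewrite ?card_initial_gt0 // -?val_eqE ?ltn_eqF //.
  exact: row_weight_move.
apply: (card_le_at_discrepancy (f := f)) => [[[i1 i2] j] [[i1' i2'] j']|[[i1 i2] j]].
  move=> /fP/=[mv _ [up down cJ]] /fP/=[mv' _ [up' down' cJ']] eq_w.
  move: up down cJ; rewrite eq_w up' down' => /set1_inj e1 /set1_inj e2.
  move: mv; rewrite -e1 -e2 => mv; rewrite cJ' => /addnI/esym eq_card.
  by rewrite (card_initial_inj mv mv' eq_card).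
by move=> /fP/=[_ leD [up down _]]; split=> //; rewrite /discrepancy up down !cards1.
Qed.

(* Configurations (B) and (B') both consist of a column satisfying [colA] and one
   satisfying [colB], in the two possible orders. *)
Definition colA i1 i2 i3 : pred 'I_n :=
  fun j => movable D i1 i2 j && ((i3, j) \in D).

Definition colB i1 i2 i3 : pred 'I_n :=
  fun j => movable D i1 i2 j && ((i3, j) \notin D).

(** Boxes go from [i3] to [i1] in [colA] columns and from [i2] to [i1] in [colB] columns; these are
    disjoint families, as they disagree in row [i3]. *)
Lemma r2_le_at_discrepancy3 : (r2 D <= at_discrepancy 3)%N.
Proof.
pose T := ('I_n * 'I_n * 'I_n * 'I_n * 'I_n)%type.
pose A := [set t : T | let: (i1, i2, i3, p, q) := t in
  [&& i1 < i2, i2 < i3, colA i1 i2 i3 p & colB i1 i2 i3 q]%N].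
pose F (t : T) : {set box n} :=
  let: (i1, i2, i3, p, q) := t in setX [set i1; i2; i3] [set p; q].
have le_A : (r2 D <= #|A|)%N.
  apply: leq_trans (leq_imset_card F A); apply/subset_leq_card/subsetP => E.
  rewrite inE => /existsP[i1 /existsP[i2 /existsP[i3 /existsP[j1 /existsP[j2]]]]].
  move=> /and5P[lt12 lt23 ltj /eqP-> cfg].
  have ne21 : (i2 == i1) = false by rewrite -val_eqE gtn_eqF.
  have ne32 : (i3 == i2) = false by rewrite -val_eqE gtn_eqF.
  have ne31 : (i3 == i1) = false by rewrite -val_eqE gtn_eqF // (ltn_trans lt12).
  have nej : (j2 == j1) = false by rewrite -val_eqE gtn_eqF.
  have ne := (ne21, ne32, ne31, nej, eq_sym i1 i2, eq_sym i2 i3, eq_sym i1 i3, eq_sym j1 j2).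
  have mem i j : i \in [set i1; i2; i3] -> j \in [set j1; j2] -> forall B : {set box n},
      setX [set i1; i2; i3] [set j1; j2] :&: D = B -> ((i, j) \in D) = ((i, j) \in B).
    by move=> iI jJ B <-; rewrite in_setI in_setX iI jJ.
  have I1 : i1 \in [set i1; i2; i3] by rewrite !inE eqxx.
  have I2 : i2 \in [set i1; i2; i3] by rewrite !inE eqxx !orbT.
  have I3 : i3 \in [set i1; i2; i3] by rewrite !inE eqxx !orbT.
  have J1 : j1 \in [set j1; j2] by rewrite !inE eqxx.
  have J2 : j2 \in [set j1; j2] by rewrite !inE eqxx !orbT.
  (* The order of [p] and [q] records the type: [p] is [j1] for (B) and [j2] for (B'). *)
  apply/imsetP; case/orP: cfg => /eqP cfg;
    [exists (i1, i2, i3, j1, j2) | exists (i1, i2, i3, j2, j1)];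
    rewrite //= ?[[set j2; j1]]setUC // inE lt12 lt23 /colA /colB /movable;
    rewrite (mem _ _ I1 J1 _ cfg) (mem _ _ I1 J2 _ cfg) (mem _ _ I2 J1 _ cfg)
      (mem _ _ I2 J2 _ cfg) (mem _ _ I3 J1 _ cfg) (mem _ _ I3 J2 _ cfg);
    by rewrite !inE !xpair_eqE !eqxx !ne.
apply: leq_trans le_A _.
pose J1 (t : T) := let: (i1, i2, i3, p, q) := t in initial (colA i1 i2 i3) p.
pose J2 (t : T) := let: (i1, i2, i3, p, q) := t in initial (colB i1 i2 i3) q.
pose f (t : T) := let: (i1, i2, i3, p, q) := t in
  move (move D i1 i3 (J1 t)) i1 i2 (J2 t).
have fP t : t \in A -> let w := row_weight (f t) in let: (i1, i2, i3, p, q) := t in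
    [/\ [/\ i2 != i3, colA i1 i2 i3 p & colB i1 i2 i3 q], (i2 < i3)%N, diagram_le (f t) D &
    [/\ increased wD w = [set i1; i1], increased w wD = [set i3; i2],
        wD i3 = w i3 + #|J1 t| & wD i2 = w i2 + #|J2 t|]%N].
  case: t => [[[[i1 i2] i3] p] q]; rewrite inE => /and4P[lt12 lt23 Ap Bq].
  have lt13 := ltn_trans lt12 lt23.
  have ne23 : i2 != i3 by rewrite -val_eqE ltn_eqF.
  have [|||leD sh] := @move2 n D i1 i3 i1 i2 (initial (colA i1 i2 i3) p)
    (initial (colB i1 i2 i3) q) lt13 lt12.
  - by move=> j; rewrite inE /colA /movable => /and3P[_ /andP[-> _] ->].
  - by move=> j; rewrite inE /colB => /and3P[_ ->].
  - left=> j; rewrite !inE /colA /colB => /and3P[_ _ /negbTE->].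
    by rewrite !andbF.
  split=> //=; apply: shift2P sh; rewrite ?card_initial_gt0 1?eq_sym //.
    by rewrite !inE -!val_eqE /= !ltn_eqF.
  by rewrite !inE -!val_eqE /= !ltn_eqF.
apply: (card_le_at_discrepancy (f := f)) =>
    [[[[[i1 i2] i3] p] q] [[[[i1' i2'] i3'] p'] q']|[[[[i1 i2] i3] p] q]].
  move=> /fP[[_ Ap Bq] lt _ [up down c1 c2]] /fP[[_ Ap' Bq'] lt' _ [up' down' c1' c2']] eq_w.
  move: up down c1 c2; rewrite eq_w up' down' !setUid => /set1_inj e1.
  (* Of the two losing rows, the upper one is [i2] and the lower one [i3]; listing them in
     increasing order identifies them. *)
  rewrite ![[set _; i2]]setUC ![[set _; i2']]setUC.
  case/(set2_ord_inj lt' lt) => e2 e3; subst i1' i2' i3'.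
  rewrite c1' c2' => /addnI/esym/(card_initial_inj Ap Ap')-> /addnI/esym.
  by move=> /(card_initial_inj Bq Bq')->.
move=> /fP[[ne _ _] _ leD [up down _ _]]; split=> //.
by rewrite /discrepancy up down setUid cards1 cards2 eq_sym ne.
Qed.

(** The two moves use disjoint pairs of rows, so they may share columns, which covers [a = b]. The
    upper gaining row is [i1] and the upper losing row [i2]. *)
Lemma r3_le_at_discrepancy4 : (r3 D <= at_discrepancy 4)%N.
Proof.
pose T := ('I_n * 'I_n * 'I_n * 'I_n * 'I_n * 'I_n)%type.
pose A := [set t : T | let: (i1, i2, i3, i4, a, b) := t in
  [&& i1 < i2, i2 < i3, i3 < i4, movable D i1 i2 a & movable D i3 i4 b]%N].
pose F (t : T) : {set box n} := let: (i1, i2, i3, i4, a, b) := t in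
  [set (i1, a); (i2, a); (i3, b); (i4, b)].
have le_A : (r3 D <= #|A|)%N.
  apply: leq_trans (leq_imset_card F A); apply/subset_leq_card/subsetP => E.
  rewrite inE => /existsP[i1 /existsP[i2 /existsP[i3 /existsP[i4 /existsP[a /existsP[b]]]]]].
  move=> /and5P[lt12 lt23 lt34 /and4P[D1 D3 D2 D4] /eqP->].
  apply/imsetP; exists (i1, i2, i3, i4, a, b) => //.
  by rewrite inE lt12 lt23 lt34 /movable D1 D2 D3.
apply: leq_trans le_A _.
pose J1 (t : T) := let: (i1, i2, i3, i4, a, b) := t in initial (movable D i1 i2) a.
pose J2 (t : T) := let: (i1, i2, i3, i4, a, b) := t in initial (movable D i3 i4) b.
pose f (t : T) := let: (i1, i2, i3, i4, a, b) := t in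
  move (move D i1 i2 (J1 t)) i3 i4 (J2 t).
have fP t : t \in A -> let w := row_weight (f t) in let: (i1, i2, i3, i4, a, b) := t in
    [/\ movable D i1 i2 a /\ movable D i3 i4 b, (i1 < i3)%N /\ (i2 < i4)%N, diagram_le (f t) D &
    [/\ increased wD w = [set i1; i3], increased w wD = [set i2; i4],
        wD i2 = w i2 + #|J1 t| & wD i4 = w i4 + #|J2 t|]%N].
  case: t => [[[[[i1 i2] i3] i4] a] b]; rewrite inE => /and5P[lt12 lt23 lt34 mva mvb].
  have lt13 := ltn_trans lt12 lt23; have lt24 := ltn_trans lt23 lt34.
  have lt14 := ltn_trans lt12 lt24.
  have [|||leD sh] := @move2 n D i1 i2 i3 i4 (initial (movable D i1 i2) a)
    (initial (movable D i3 i4) b) lt12 lt34.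
  - by move=> j; rewrite inE => /andP[].
  - by move=> j; rewrite inE => /andP[].
  - right; rewrite disjoint_subset; apply/subsetP => i; rewrite !inE -!val_eqE /=; lia.
  split=> //=; apply: shift2P sh; rewrite ?card_initial_gt0 // ?inE -?val_eqE /=; lia.
apply: (card_le_at_discrepancy (f := f)) =>
    [[[[[[i1 i2] i3] i4] a] b] [[[[[i1' i2'] i3'] i4'] a'] b']|[[[[[i1 i2] i3] i4] a] b]].
  move=> /fP[[ma mb] [lt13 lt24] _ [up down c1 c2]].
  move=> /fP[[ma' mb'] [lt13' lt24'] _ [up' down' c1' c2']] eq_w.
  move: up down c1 c2; rewrite eq_w up' down'.
  case/(set2_ord_inj lt13' lt13) => e1 e3; case/(set2_ord_inj lt24' lt24) => e2 e4.
  subst i1' i2' i3' i4'.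
  rewrite c1' c2' => /addnI/esym/(card_initial_inj ma ma')-> /addnI/esym.
  by move=> /(card_initial_inj mb mb')->.
move=> /fP[_ [lt13 lt24] leD [up down _ _]]; split=> //.
by rewrite /discrepancy up down !cards2 -!val_eqE !ltn_eqF.
Qed.

Lemma size_weights_ge : (1 + r1 D + r2 D + r3 D <= size W)%N.
Proof.
apply: (@leq_trans (at_discrepancy 0 + at_discrepancy 2 + at_discrepancy 3 + at_discrepancy 4)).
  have := (le1_at_discrepancy0, r1_le_at_discrepancy2, r2_le_at_discrepancy3,
    r3_le_at_discrepancy4); case=> [[[h0 h2] h3] h4].
  by rewrite !leq_add.
(* Each weight has a single discrepancy, so it enters at most one of the four counts. *)
rewrite /at_discrepancy; move: W; elim=> //= w s IHs.
have : ((discrepancy wD w == 0) + (discrepancy wD w == 2) + (discrepancy wD w == 3)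
  + (discrepancy wD w == 4) <= 1)%N by case: (discrepancy wD w) => [|[|[|[|[|]]]]].
lia.
Qed.

End Counting.

Theorem theorem1p3 (R : realType) (n : nat) (D : diagram n) :
  (theta R[i] D >= 1 + r1 D + r2 D + r3 D)%N.
Proof.
(* Here [W] is the support of the dual character, whose size is [theta] by definition. *)
apply: size_weights_ge => C leCD.
exact: (@row_weight_msupp R[i] n C D leCD).
Qed.
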